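(* Let $t<n/3$. Consider the one-round protocol WC on $n$ processors in which each $p_i$ with input bit $x_i$ sends $x_i$ to every $p_j$; $p_j$ lets $P_j^0$ (resp. $P_j^1$) be the set of processors from which it received $0$ (resp. $1$), and sets $y_j:=0$ if $|P_j^0|>2n/3$, else $y_j:=1$ if $|P_j^1|>2n/3$, else $y_j:=\bot$. Against an eventually-stationary mobile Byzantine $t$-MAd adversary, WC satisfies: (weak consistency) there is $y\in\{0,1\}$ such that every $p_j$ sets $y_j\in\{y,\bot\}$; (persistency) if every processor has the same input $x$ then every $p_j$ sets $y_j=x$; (termination) every processor sets its value $y_j$ after a single round.
   Context: System: $n$ processors run a synchronous round-based protocol; each round every processor sends a (possibly different) message to every processor over dedicated point-to-point channels whose receiver knows the sender identity; messages of round $\rho$ are delivered by the start of round $\rho+1$. A message adversary (MAd) sees all messages; in the Byzantine type it may delete or arbitrarily replace any outgoing message, in a given round, of the processors it corrupts in that round; it never alters internal states, inputs, outputs or incoming messages. A mobile $t$-MAd adversary corrupts at most $t$ processors per round, possibly different each round; an eventually-stationary mobile $t$-MAd adversary behaves as a mobile $t$-MAd adversary for a finite, unknown number of rounds and thereafter confines its corruptions to a fixed set of at most $t$ processors. All guarantees apply to all processors, corrupted or not. *)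

(* Defs.v *)
From mathcomp Require Import all_boot.

Set Implicit Arguments.
Unset Strict Implicit.
Unset Printing Implicit Defensive.

(* Arbitrary bit strings, so that a replaced message need not be one that the
   protocol could have sent. *)
Definition message := seq bool.

(* [m i j] is the message on the channel from p_i to p_j in a given round
   ([None]: no message). The channel from p_i to itself is included. *)
Definition traffic (n : nat) := 'I_n -> 'I_n -> option message.

(* Rounds are numbered from 0. [output s] is [None] as long as the output has
   not been set in state [s]. *)
Record protocol (n : nat) (I O : Type) := Protocol {
  state : Type;
  init : 'I_n -> I -> state;
  send : nat -> 'I_n -> state -> 'I_n -> option message;
  step : nat -> 'I_n -> state -> ('I_n -> option message) -> state;
  output : state -> option O }.

(* A Byzantine message adversary. Its choices for a round depend on all the
   messages sent so far, those of the current round included (at the head of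
   the list); the messages delivered earlier are determined by its own past
   choices. *)
Record adversary (n : nat) := Adversary {
  corrupt : seq (traffic n) -> {set 'I_n};
  tamper : seq (traffic n) -> traffic n }.

Section Execution.

Variables (n : nat) (I O : Type) (P : protocol n I O).
Variables (x : 'I_n -> I) (A : adversary n).

Definition sent (r : nat) (s : 'I_n -> state P) : traffic n :=
  fun i j => send r i (s i) j.

(* Only the outgoing messages of the processors corrupted in the current round
   are under the adversary's control; states are not. *)
Definition delivered (h : seq (traffic n)) (m : traffic n) : traffic n :=
  fun i j => if i \in corrupt A h then tamper A h i j else m i j.

(* The states after [r] rounds, and the messages sent in these rounds, latest
   round first. *)
Fixpoint run (r : nat) : ('I_n -> state P) * seq (traffic n) :=
  if r is r'.+1 then
    let: (s, h) := run r' in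
    let m := sent r' s in
    let h' := m :: h in
    (fun j => step r' j (s j) (fun i => delivered h' m i j), h')
  else (fun i => init P i (x i), [::]).

Definition corrupted (r : nat) : {set 'I_n} := corrupt A (run r.+1).2.

Definition eventually_stationary (t : nat) : Prop :=
  exists (T : nat) (F : {set 'I_n}),
    [/\ forall r, r < T -> #|corrupted r| <= t,
        #|F| <= t
      & forall r, T <= r -> corrupted r \subset F].

(* p_j sets its output to [v], once and for all, at the end of the [k]-th
   round. *)
Definition sets_after (k : nat) (j : 'I_n) (v : O) : Prop :=
  forall r, output ((run r).1 j) = if r < k then None else Some v.

End Execution.

(* In outputs, [None] stands for the value bot. The bounds |P_j^b| > 2n/3 are
   between real numbers, hence the cleared denominators. *)
Definition WC_output (n : nat) (rcv : 'I_n -> option message) : option bool :=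
  let P (b : bool) := [set i | rcv i == Some [:: b]] in
  if 2 * n < 3 * #|P false| then Some false
  else if 2 * n < 3 * #|P true| then Some true
  else None.

(* State [inl b]: running with input [b]; state [inr y]: finished with
   output [y]. *)
Definition WC (n : nat) : protocol n bool (option bool) := {|
  state := bool + option bool;
  init := fun _ b => inl b;
  send := fun _ _ s _ => if s is inl b then Some [:: b] else None;
  step := fun _ _ s rcv => if s is inl _ then inr (WC_output rcv) else s;
  output := fun s => if s is inr y then Some y else None |}.

(* Main.v *)
(* A set of more than 2n/3 processors and another one meet in more than n/3 > t
   processors, hence in an uncorrupted one, which sends the same bit to both
   receivers: two receivers cannot set opposite bits. For persistency, the at
   least n - t > 2n/3 uncorrupted processors all deliver the common input. *)
Require Import Defs.
From mathcomp Require Import all_boot zify.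

Set Implicit Arguments.
Unset Strict Implicit.
Unset Printing Implicit Defensive.

(** The sets of senders of [false] and of [true] are disjoint, so at most one exceeds 2n/3; hence
    testing [false] first does not favour it. *)
Lemma WC_outputE (n : nat) (rcv : 'I_n -> option message) (b : bool) :
  (WC_output rcv == Some b) = (2 * n < 3 * #|[set i | rcv i == Some [:: b]]|).
Proof.
rewrite /WC_output.
set P0 := [set i | rcv i == Some [:: false]].
set P1 := [set i | rcv i == Some [:: true]].
have P01 : #|P0| + #|P1| <= n.
  have P01 : P0 :&: P1 = set0.
    by apply/setP => i; rewrite !inE; case: eqP => // ->.
  by rewrite -cardsUI P01 cards0 addn0 -[leqRHS]card_ord max_card.
case: b; rewrite -?/P0 -?/P1.
  case: ifP => [gt0 | _]; last by case: ifP.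
  by apply/esym/negbTE; lia.
by case: ifP => // _; case: ifP.
Qed.

Section WeakConsistency.

Variables (n t : nat) (x : 'I_n -> bool) (A : adversary n).

Let inputs : traffic n := fun i _ => Some [:: x i].

(** In round 0 the history shown to the adversary is just the current traffic. *)
Definition received (j i : 'I_n) : option message := delivered A [:: inputs] inputs i j.

Let C : {set 'I_n} := corrupted (WC n) x A 0.

Lemma WC_sets_after (j : 'I_n) :
  sets_after (WC n) x A 1 j (WC_output (received j)).
Proof.
case=> // r; elim: r => [|r] //=.
case: (run _ x A r) => s h /=.
(* The split is on the state of [j] after [r.+1] rounds: [inl] contradicts the induction hypothesis,
   and [inr] is kept by [step]. *)
by case: (if s j is inl _ then _ else _).
Qed.

(** Round 0 is in the mobile phase, or already in the stationary one if the switch occurs at 0;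
    either phase gives the bound. *)
Lemma eventually_stationary_corrupted0 :
  eventually_stationary (WC n) x A t -> #|C| <= t.
Proof.
case=> [[|T]] [F [mobile leFt stationary]]; last exact: mobile.
exact: leq_trans (subset_leq_card (stationary 0 _)) leFt.
Qed.

Lemma received_uncorrupted (j i : 'I_n) :
  i \notin C -> received j i = Some [:: x i].
Proof. by rewrite /received /delivered => /negbTE ->. Qed.

Lemma WC_output_agree (j k : 'I_n) : 3 * t < n -> #|C| <= t ->
  WC_output (received j) = Some false -> WC_output (received k) <> Some true.
Proof.
move=> tn leCt /eqP; rewrite WC_outputE => Pj /eqP; rewrite WC_outputE => Pk.
set P0 := [set i | _] in Pj; set P1 := [set i | _] in Pk.
have sub : P0 :&: P1 \subset C.
  apply/subsetP => i; rewrite !inE; apply: contraLR => iC.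
  by rewrite !received_uncorrupted //; case: (x i).
have leU : #|P0 :|: P1| <= n by rewrite -[leqRHS]card_ord max_card.
have leI := leq_trans (subset_leq_card sub) leCt.
(* Inclusion-exclusion would make the intersection larger than 2(2n/3) - n = n/3 > t. *)
have := cardsUI P0 P1; lia.
Qed.

Lemma WC_output_persistent (b : bool) (j : 'I_n) : 3 * t < n -> #|C| <= t ->
  (forall i, x i = b) -> WC_output (received j) = Some b.
Proof.
move=> tn leCt xb; apply/eqP; rewrite WC_outputE.
set Pb := [set i | _].
have sub : ~: C \subset Pb.
  by apply/subsetP => i; rewrite !inE => iC; rewrite received_uncorrupted // xb.
have leb : n - t <= #|Pb|.
  apply: leq_trans (subset_leq_card sub).
  by rewrite cardsCs setCK card_ord leq_sub2l.
lia.
Qed.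

End WeakConsistency.

Theorem theorem5p2 (n t : nat) (tn : 3 * t < n) (x : 'I_n -> bool)
    (A : adversary n) (hA : eventually_stationary (WC n) x A t) :
  [/\ (* weak consistency *)
      exists y : bool, forall j : 'I_n, exists (k : nat) (v : option bool),
        sets_after (WC n) x A k j v /\ (v = Some y \/ v = None),
      (* persistency *)
      forall b : bool, (forall i : 'I_n, x i = b) ->
        forall j : 'I_n, exists k : nat, sets_after (WC n) x A k j (Some b)
    & (* termination *)
      forall j : 'I_n, exists v : option bool, sets_after (WC n) x A 1 j v].
Proof.
have leCt := eventually_stationary_corrupted0 hA.
have sets j := WC_sets_after x A j.
pose out j := WC_output (received x A j).
split.
(* Take y to be [true] if some processor outputs it, since agreement then excludes [false];
   otherwise only [false] and bot occur. *)
- have [/existsP[k /eqP outk] | /existsPn no1] :=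
    boolP [exists k, out k == Some true].
    exists true => j; exists 1, (out j); split=> //.
    case outj: (out j) => [[]|]; [by left | | by right].
    by case: (WC_output_agree tn leCt outj outk).
  exists false => j; exists 1, (out j); split=> //.
  by move: (no1 j); case: (out j) => [[]|] //; [left | right].
- by move=> b xb j; exists 1; rewrite -(WC_output_persistent j tn leCt xb).
- by move=> j; exists (out j).
Qed.
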